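(* Let $n\ge 1$, let $k\in\mathbb{N}$, and let $0\le m\le |\mathbb{S}^n|$. Then the problem $$\sup\left\{\mu_k(\rho)\;:\;\rho:\mathbb{S}^n\to[0,1]\text{ measurable},\ \int_{\mathbb{S}^n}\rho=m\right\}$$ has a solution, i.e. there exists a measurable $\rho^*:\mathbb{S}^n\to[0,1]$ with $\int_{\mathbb{S}^n}\rho^*=m$ at which the supremum is attained.
   Context: $\mathbb{S}^n=\{x\in\mathbb{R}^{n+1}:\|x\|=1\}$ is the unit sphere with its standard Riemannian metric; integrals are with respect to its surface measure, $|\mathbb{S}^n|$ is its total measure, and $\nabla$ is the Riemannian gradient. For a density $\rho\in L^\infty(\mathbb{S}^n,[0,1])$ and an integer $k\ge 0$, the generalized Neumann eigenvalue is $$\mu_k(\rho):=\inf_{V\in\mathcal{V}_{k+1}}\ \max_{u\in V\setminus\{0\}}\ \frac{\int_{\mathbb{S}^n}\rho|\nabla u|^2}{\int_{\mathbb{S}^n}\rho u^2},$$ where $\mathcal{V}_{k+1}$ is the family of $(k+1)$-dimensional subspaces of $\{u\cdot 1_{\{\rho(x)>0\}}:u\in C_c^\infty(\mathbb{S}^n)\}$ (functions identified when equal almost everywhere). For an element $u\cdot 1_{\{\rho>0\}}$, the integrals in the quotient are computed with the smooth function $u$ and its gradient; they depend only on the values of $u$ almost everywhere on $\{\rho>0\}$. The infimum over an empty family is $+\infty$ (this only matters when $m=0$). *)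

(* Defs.v *)
From HB Require Import structures.
From mathcomp Require Import all_boot all_order all_algebra.
From mathcomp Require Import all_classical all_reals all_analysis.
From mathcomp Require Import measurable_realfun.

Set Implicit Arguments.
Unset Strict Implicit.
Unset Printing Implicit Defensive.

Import Order.TTheory GRing.Theory Num.Theory.
Import numFieldNormedType.Exports.

Local Open Scope classical_set_scope.
Local Open Scope ring_scope.

(* 'rV[R]_n carries the sigma-algebra generated by the coordinates, which is
   its Borel sigma-algebra. *)
Definition rV_display : measure_display. Proof. by constructor. Qed.

Section measurable_rV.
Context {R : realType} (n : nat).

Definition rV_coord (i : 'I_n) (x : 'rV[R]_n) : R := x ord0 i.

Let rV_set0 : g_sigma_preimage rV_coord set0.
Proof. exact: sigma_algebra0. Qed.

Let rV_setC A : g_sigma_preimage rV_coord A -> g_sigma_preimage rV_coord (~` A).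
Proof. exact: sigma_algebraC. Qed.

Let rV_bigcup (F : _^nat) : (forall i, g_sigma_preimage rV_coord (F i)) ->
  g_sigma_preimage rV_coord (\bigcup_i (F i)).
Proof. exact: sigma_algebra_bigcup. Qed.

HB.instance Definition _ := @isMeasurable.Build rV_display 'rV[R]_n
  (g_sigma_preimage rV_coord) rV_set0 rV_setC rV_bigcup.

Lemma measurable_rV_coord (i : 'I_n) :
  measurable_fun [set: 'rV[R]_n] (rV_coord i).
Proof.
move=> _ Y mY; rewrite setTI; apply: sub_sigma_algebra => /=.
rewrite -bigcup_seq/=; exists i => /=; first by rewrite mem_index_enum.
by exists Y => //; rewrite setTI.
Qed.

Lemma measurable_fun_rV d (T : measurableType d) (f : T -> 'rV[R]_n) :
  (forall i, measurable_fun [set: T] (rV_coord i \o f)) ->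
  measurable_fun [set: T] f.
Proof.
move=> mf _ A mA; rewrite setTI.
suff : g_sigma_preimage rV_coord `<=` [set B | measurable (f @^-1` B)] by apply.
apply: smallest_sub.
  split => /=.
  - by rewrite preimage_set0.
  - by move=> B mB; rewrite setTD preimage_setC; exact: measurableC.
  - by move=> F mF; rewrite preimage_bigcup; exact: bigcupT_measurable.
rewrite -bigcup_seq; apply: bigcup_sub => i _ B [C mC <-] /=.
by have := mf i measurableT _ mC; rewrite !setTI.
Qed.

End measurable_rV.

Section lebesgue_rV.
Context {R : realType}.

Definition rV_cons n (p : measurableTypeR R * 'rV[R]_n) : 'rV[R]_n.+1 :=
  \row_i oapp (p.2 ord0) p.1 (unlift ord0 i).

Definition rV_uncons n (x : 'rV[R]_n.+1) :
    measurableTypeR R * 'rV[R]_n :=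
  (x ord0 ord0, \row_i x ord0 (lift ord0 i)).

Lemma rV_consK n : cancel (@rV_cons n) (@rV_uncons n).
Proof.
move=> [t y]; rewrite /rV_uncons mxE unlift_none/=; congr (_, _).
by apply/rowP => i; rewrite !mxE liftK.
Qed.

Lemma measurable_rV_cons n : measurable_fun [set: measurableTypeR R * 'rV[R]_n] (@rV_cons n).
Proof.
apply: measurable_fun_rV => i.
case: (unliftP ord0 i) => [j|] ->.
  rewrite (_ : _ \o _ = rV_coord j \o snd).
    exact: (measurableT_comp (measurable_rV_coord j) measurable_snd).
  by apply/funext => p; rewrite /rV_coord/= mxE liftK.
rewrite (_ : _ \o _ = fst); first exact: measurable_fst.
by apply/funext => p; rewrite /rV_coord/= mxE unlift_none.
Qed.

Lemma measurable_rV_uncons n : measurable_fun [set: 'rV[R]_n.+1] (@rV_uncons n).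
Proof.
apply/measurable_fun_pairP; split; first exact: measurable_rV_coord.
apply: measurable_fun_rV => i.
rewrite (_ : _ \o _ = rV_coord (lift ord0 i)); first exact: measurable_rV_coord.
by apply/funext => x; rewrite /rV_coord/= mxE.
Qed.

Section cons_measure.
Context n (m : {sigma_finite_measure set 'rV[R]_n -> \bar R}).

Definition cons_measure : set 'rV[R]_n.+1 -> \bar R :=
  pushforward (@lebesgue_measure R \x m)%E (@rV_cons n).

Let cons_measure0 : cons_measure set0 = 0%E.
Proof. by rewrite /cons_measure /pushforward preimage_set0 measure0. Qed.

Let cons_measure_ge0 A : (0 <= cons_measure A)%E.
Proof. by rewrite /cons_measure /pushforward; exact: measure_ge0. Qed.

Let cons_measure_sigma_additive : semi_sigma_additive cons_measure.
Proof.
have mf A : measurable A -> measurable (@rV_cons n @^-1` A).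
  by move=> mA; rewrite -[X in measurable X]setTI; exact: measurable_rV_cons.
move=> F mF tF mUF; rewrite /cons_measure /pushforward preimage_bigcup.
apply: measure_semi_sigma_additive => [i||]; first exact: mf.
- apply/trivIsetP => /= i j _ _ ij; rewrite -preimage_setI.
  by move/trivIsetP : tF => /(_ _ _ _ _ ij) ->//; rewrite preimage_set0.
- by rewrite -preimage_bigcup; exact: mf.
Qed.

HB.instance Definition _ := isMeasure.Build _ _ _ cons_measure
  cons_measure0 cons_measure_ge0 cons_measure_sigma_additive.

Let cons_measure_sigma_finite : sigma_finite setT cons_measure.
Proof.
have /sigma_finiteP[F [TF ndF Foo]] := sigma_finiteT (@lebesgue_measure R).
have /sigma_finiteP[G [TG ndG Goo]] := sigma_finiteT m.
exists (fun k => @rV_uncons n @^-1` (F k `*` G k)) => [|k].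
  rewrite -preimage_bigcup (_ : \bigcup_k _ = setT) ?preimage_setT//.
  rewrite -subTset => -[x y] _ /=.
  have [i _ Fix] : (\bigcup_i F i) x by rewrite -TF.
  have [j _ Gjy] : (\bigcup_i G i) y by rewrite -TG.
  exists (maxn i j) => //; split.
  - by move: x Fix; exact/subsetPset/ndF/leq_maxl.
  - by move: y Gjy; exact/subsetPset/ndG/leq_maxr.
have [mFk Fkoo] := Foo k; have [mGk Gkoo] := Goo k.
have mFGk : measurable (F k `*` G k) by exact: measurableX.
split; first by rewrite -[X in measurable X]setTI; exact: measurable_rV_uncons.
rewrite /cons_measure /pushforward -comp_preimage (_ : _ \o _ = id).
  by rewrite preimage_id product_measure1E// lte_mul_pinfty// ge0_fin_numE.
by apply/funext => p /=; rewrite rV_consK.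
Qed.

HB.instance Definition _ := Measure_isSigmaFinite.Build _ _ _ cons_measure
  cons_measure_sigma_finite.

End cons_measure.

Fixpoint lebesgue_rV n : {sigma_finite_measure set 'rV[R]_n -> \bar R} :=
  if n is n'.+1 then cons_measure (lebesgue_rV n') else \d_(0 : 'rV[R]_0).

End lebesgue_rV.

Section sphere.
Context {R : realType}.

Definition dotrV n (x y : 'rV[R]_n) : R := \sum_i x ord0 i * y ord0 i.

(* The library norm on 'rV[R]_n is the sup norm; this is the Euclidean one. *)
Definition enorm n (x : 'rV[R]_n) : R := Num.sqrt (dotrV x x).

Definition sphere n : set 'rV[R]_n.+1 := [set x | enorm x = 1].

Definition radial n (x : 'rV[R]_n) : 'rV[R]_n := (enorm x)^-1 *: x.

Lemma measurable_enorm n : measurable_fun [set: 'rV[R]_n] (@enorm n).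
Proof.
rewrite (_ : @enorm n = (fun t => powR t 2^-1) \o (fun x => dotrV x x)).
  apply: measurableT_comp; first exact: measurable_powR.
  by apply: measurable_sum => i; apply: measurable_funM; exact: measurable_rV_coord.
apply/funext => x /=; rewrite powR12_sqrt// /dotrV sumr_ge0// => i _.
by rewrite -expr2 sqr_ge0.
Qed.

Lemma measurable_radial n : measurable_fun [set: 'rV[R]_n] (@radial n).
Proof.
apply: measurable_fun_rV => i.
rewrite (_ : _ \o _ = (fun x => (enorm x)^-1 * rV_coord i x)).
  apply: measurable_funM; last exact: measurable_rV_coord.
  rewrite (_ : (fun _ => _) = (fun x => powR x (-1)) \o @enorm n).
    exact: (measurableT_comp (measurable_powR _) (@measurable_enorm n)).
  by apply/funext => x /=; rewrite powR_inv1// sqrtr_ge0.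
by apply/funext => x; rewrite /rV_coord /= /radial mxE.
Qed.


(* The unit ball without its centre, on which [radial] is the retraction onto
   the sphere. *)
Definition punctured_ball n : set 'rV[R]_n := [set x | 0 < enorm x <= 1].

Lemma measurable_punctured_ball n : measurable (@punctured_ball n).
Proof.
have -> : @punctured_ball n = @enorm n @^-1` `]0, 1]%classic.
  by apply/seteqP; split => x /=; rewrite in_itv.
by rewrite -[X in measurable X]setTI; exact: measurable_enorm.
Qed.

(* The Lebesgue measure of the truncated cone {t a : a in A, 0 < t <= 1} over
   the part of A on the sphere. *)
Definition cone_measure n (A : set 'rV[R]_n.+1) : \bar R :=
  lebesgue_rV n.+1 (@radial n.+1 @^-1` A `&` @punctured_ball n.+1).

Section cone_measure_instance.
Variable n : nat.

Let mcone A : measurable A ->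
  measurable (@radial n.+1 @^-1` A `&` @punctured_ball n.+1).
Proof.
move=> mA; apply: measurableI; last exact: measurable_punctured_ball.
by rewrite -[X in measurable X]setTI; exact: measurable_radial.
Qed.

Let cone_measure0 : @cone_measure n set0 = 0%E.
Proof. by rewrite /cone_measure preimage_set0 set0I measure0. Qed.

Let cone_measure_ge0 A : (0 <= @cone_measure n A)%E.
Proof. by rewrite /cone_measure; exact: measure_ge0. Qed.

Let cone_measure_sigma_additive : semi_sigma_additive (@cone_measure n).
Proof.
move=> F mF tF mUF; rewrite /cone_measure preimage_bigcup setI_bigcupl.
apply: measure_semi_sigma_additive => [i||]; first exact: mcone.
- apply/trivIsetP => /= i j _ _ ij; rewrite setIACA -preimage_setI.
  by move/trivIsetP : tF => /(_ _ _ _ _ ij) ->//; rewrite preimage_set0 set0I.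
- by rewrite -setI_bigcupl -preimage_bigcup; exact: mcone.
Qed.

HB.instance Definition _ := isMeasure.Build _ _ _ (@cone_measure n)
  cone_measure0 cone_measure_ge0 cone_measure_sigma_additive.

End cone_measure_instance.

(* The surface measure of the unit sphere of R^(n+1), by polar coordinates:
   it is n + 1 times the cone measure, because the integral of t^n over
   [0, 1] is 1 / (n + 1).  It is a Borel measure on the ambient space, carried
   by [sphere n]. *)
Definition surface_measure n : set 'rV[R]_n.+1 -> \bar R :=
  mscale (n.+1%:R)%:nng (@cone_measure n).

HB.instance Definition _ n := Measure.on (@surface_measure n).

End sphere.

Section smooth.
Context {R : realType}.

Definition partial n (i : 'I_n) (f : 'rV[R]_n -> R) : 'rV[R]_n -> R :=
  fun x => 'D_(delta_mx ord0 i) f x.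

Fixpoint Ck_on n (k : nat) (O : set 'rV[R]_n) (f : 'rV[R]_n -> R) : Prop :=
  if k is k'.+1 then
    (forall x, O x -> differentiable f x) /\
    (forall i, Ck_on k' O (partial i f))
  else forall x, O x -> {for x, continuous f}.

(* A function on the sphere is represented by a function on the ambient space
   of which only the values on the sphere matter.  Since [radial] is a smooth
   submersion of the punctured space onto the sphere which is the identity on
   the sphere, u is smooth on the sphere iff u \o radial is smooth on the
   punctured space. *)
Definition smooth_sphere n (u : 'rV[R]_n.+1 -> R) : Prop :=
  forall k, Ck_on k [set x | x != 0] (u \o @radial R n.+1).

(* For x on the sphere and h in the ambient space, 'D_h (u \o radial) x is the
   derivative of u along the curve t |-> radial (x + t h) of the sphere, whose
   velocity at x is the tangential part of h.  So the vector below is tangent to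
   the sphere at x and represents the differential of u for the metric induced
   by R^(n+1): it is the Riemannian gradient. *)
Definition sphere_grad n (u : 'rV[R]_n.+1 -> R) (x : 'rV[R]_n.+1) :
    'rV[R]_n.+1 :=
  \row_i partial i (u \o @radial R n.+1) x.

End smooth.

Section neumann.
Context {R : realType} (n : nat).

Local Notation E := 'rV[R]_n.+1.
Local Notation S := (@sphere R n).
Local Notation sigma := (@surface_measure R n).

Definition densities (m : R) : set (E -> R) :=
  [set rho : E -> R | [/\ measurable_fun S rho,
                 forall x, S x -> 0 <= rho x <= 1 &
                 (\int[sigma]_(x in S) (rho x)%:E = m%:E)%E]].

(* Equality almost everywhere of u 1_{rho > 0} and v 1_{rho > 0}. *)
Definition eq_on_support (rho u v : E -> R) : Prop :=
  {ae sigma, forall x, S x -> 0 < rho x -> u x = v x}.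

Definition lincomb d (u : 'I_d -> E -> R) (c : 'I_d -> R) : E -> R :=
  fun x => \sum_i c i * u i x.

(* The d-dimensional subspaces of { u 1_{rho > 0} : u smooth }, functions being
   identified when equal almost everywhere.  An element u 1_{rho > 0} is
   represented by the smooth function u, so that V is the span of d smooth
   functions whose products with 1_{rho > 0} are linearly independent modulo
   equality almost everywhere.  The Rayleigh quotient of an element does not
   depend on its representative, since the gradient of a smooth function
   vanishes almost everywhere on its zero set. *)
Definition test_spaces (rho : E -> R) (d : nat) : set (set (E -> R)) :=
  [set V | exists u : 'I_d -> E -> R,
    [/\ forall i, smooth_sphere (u i),
        forall c, eq_on_support rho (lincomb u c) (cst 0) ->
          forall i, c i = 0 &
        V = range (lincomb u)]].

Definition rayleigh (rho u : E -> R) : R :=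
  (\int[sigma]_(x in S) (rho x * enorm (sphere_grad u x) ^+ 2)) /
  (\int[sigma]_(x in S) (rho x * u x ^+ 2)).

(* The inner supremum is a maximum, V being finite-dimensional; the outer infimum
   is +oo when there is no test space. *)
Definition neumann_eigenvalue (k : nat) (rho : E -> R) : \bar R :=
  ereal_inf [set ereal_sup [set (rayleigh rho v)%:E |
                             v in V `\` [set v | eq_on_support rho v (cst 0)]] |
              V in test_spaces rho k.+1].

End neumann.

(* Main.v *)
(* The functional mu_k is upper semicontinuous for the weak-* topology of
   L^oo, in which the densities of mass m form a compact set.  Compactness:
   along an ultrafilter of densities, A |-> lim \int_A rho is a measure
   dominated by the surface measure, and its Radon-Nikodym derivative is the
   limit density.  Semicontinuity: for test functions u_0, ..., u_k which are
   independent for the limit density, the maximum of the Rayleigh quotient is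
   smaller than c iff the quadratic form c \int rho u^2 - \int rho |grad u|^2 is
   positive definite on their span; its coefficients converge, and positive
   definiteness is an open condition. *)
Require Import Defs.
From HB Require Import structures.
From mathcomp Require Import all_boot all_order all_algebra.
From mathcomp Require Import all_classical all_reals all_analysis.
From mathcomp Require Import measurable_realfun ring lra.

Import Order.TTheory GRing.Theory Num.Theory.
Import numFieldNormedType.Exports.
Local Open Scope classical_set_scope.
Local Open Scope ring_scope.

Set Implicit Arguments.
Unset Strict Implicit.
Unset Printing Implicit Defensive.

(** The values stay in the compact segment [[-K, K]], so they cluster at some [l]; along an
    ultrafilter a cluster point is already a limit. *)
Lemma ultra_cvg_bounded (R : realType) (I : Type) (U : set_system I)
    (UU : UltraFilter U) (a : I -> R) (K : R) :
  (forall i, `|a i| <= K) -> exists l : R, a @ U --> l.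
Proof.
move=> aK.
have [|l [_ cl]] := @segment_compact R (- K) K (a @ U).
  by apply: (@filterE _ U) => i; rewrite /= in_itv/= -ler_norml.
exists l => B /= Bl.
have [//|UB] := in_ultra_setVsetC (a @^-1` B) UU.
by have [x []] := cl (~` B) B UB Bl.
Qed.

(** * Bounded measurable functions on a set of finite measure *)

Section bounded_measurable.
Context d (T : measurableType d) (R : realType).
Variables (mu : {finite_measure set T -> \bar R}) (D : set T).
Hypothesis mD : measurable D.
Implicit Types f g : T -> R.

(** This is the class of test functions for the weak-* convergence. It is stable under sums and
    products and consists of integrable functions, so one predicate settles every integrability
    condition below. *)
Definition bounded_mfun f :=
  measurable_fun D f /\ exists K, forall x, D x -> `|f x| <= K.

Lemma bounded_mfun_integrable f :
  bounded_mfun f -> mu.-integrable D (EFin \o f).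
Proof.
move=> [mf [K fK]]; apply: measurable_bounded_integrable => //.
  by rewrite ltey_eq fin_num_measure.
exists K; split; first exact: num_real.
by move=> M KM x Dx; apply: (le_trans (fK _ Dx)); exact: ltW.
Qed.

Lemma bounded_mfun_cst c : bounded_mfun (fun=> c).
Proof. by split; [exact: measurable_cst|exists `|c|]. Qed.

Lemma bounded_mfunD f g :
  bounded_mfun f -> bounded_mfun g -> bounded_mfun (fun x => f x + g x).
Proof.
move=> [mf [K fK]] [mg [L gL]]; split; first exact: measurable_funD.
by exists (K + L) => x Dx; rewrite (le_trans (ler_normD _ _))// lerD ?fK ?gL.
Qed.

Lemma bounded_mfunM f g :
  bounded_mfun f -> bounded_mfun g -> bounded_mfun (fun x => f x * g x).
Proof.
move=> [mf [K fK]] [mg [L gL]]; split; first exact: measurable_funM.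
by exists (K * L) => x Dx; rewrite normrM ler_pM ?fK ?gL.
Qed.

Lemma bounded_mfun_indic (A : set T) :
  measurable A -> bounded_mfun (\1_A : T -> R).
Proof.
move=> mA; split; first exact: measurable_indic.
by exists 1 => x _; rewrite indicE normr_nat lern1 leq_b1.
Qed.

Lemma bounded_mfun_sum (J : Type) (s : seq J) (F : J -> T -> R) :
  (forall j, bounded_mfun (F j)) -> bounded_mfun (fun x => \sum_(j <- s) F j x).
Proof.
move=> bF; elim: s => [|j s IH].
  under eq_fun do rewrite big_nil; exact: bounded_mfun_cst.
under eq_fun do rewrite big_cons; exact: bounded_mfunD.
Qed.

Lemma bounded_mfun01 f :
  measurable_fun D f -> (forall x, D x -> 0 <= f x <= 1) -> bounded_mfun f.
Proof.
move=> mf f01; split=> //; exists 1 => x /f01 /andP[f0 f1].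
by rewrite ger0_norm.
Qed.

Lemma Rintegral_norm_le f (K : R) : bounded_mfun f ->
  (forall x, D x -> `|f x| <= K) ->
  `|\int[mu]_(x in D) f x| <= K * fine (mu D).
Proof.
move=> bf fK; have intf := bounded_mfun_integrable bf.
apply: (le_trans (le_normr_Rintegral mD intf)).
rewrite -Rintegral_cst//; apply: le_Rintegral => //.
  exact: (integrable_norm intf).
exact: bounded_mfun_integrable (bounded_mfun_cst K).
Qed.

Lemma Rintegral_sum (J : Type) (s : seq J) (F : J -> T -> R) :
  (forall j, bounded_mfun (F j)) ->
  \int[mu]_(x in D) (\sum_(j <- s) F j x) =
  \sum_(j <- s) \int[mu]_(x in D) F j x.
Proof.
move=> bF; elim: s => [|j s IH].
  rewrite big_nil; under eq_Rintegral do rewrite big_nil.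
  by rewrite Rintegral_cst// mul0r.
rewrite big_cons -IH -RintegralD//; last 2 first.
- exact: bounded_mfun_integrable.
- by apply: bounded_mfun_integrable; exact: bounded_mfun_sum.
by apply: eq_Rintegral => x _; rewrite big_cons.
Qed.

End bounded_measurable.

(** * Countable additivity of dominated additive set functions *)

Section dominated_set_function.
Context d (T : measurableType d) (R : realType).
Implicit Types phi nu : set T -> R.

(** Finite additivity turns the partial sum into the value of [phi] on a finite union, and
    nonnegativity of [phi] on the remaining part gives monotonicity. *)
Lemma additive_sum_le phi (F : nat -> set T) (n : nat) :
  (forall A, measurable A -> 0 <= phi A) ->
  (forall A B, measurable A -> measurable B -> A `&` B = set0 ->
    phi (A `|` B) = phi A + phi B) ->
  (forall i, measurable (F i)) -> trivIset setT F ->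
  \sum_(0 <= i < n) phi (F i) <= phi (\bigcup_i F i).
Proof.
move=> phi0 phiD mF tF.
have mUn k : measurable (\big[setU/set0]_(i < k) F i).
  by apply: bigsetU_measurable => i _.
have mU : measurable (\bigcup_i F i) by exact: bigcup_measurable.
have -> : \sum_(0 <= i < n) phi (F i) = phi (\big[setU/set0]_(i < n) F i).
  elim: n => [|n IH].
    rewrite big_nil big_ord0.
    (* Additivity for two empty sets forces [phi set0 = 0]. *)
    have := phiD set0 set0 measurable0 measurable0 (setI0 _).
    by rewrite setU0; lra.
  rewrite big_nat_recr//= big_ord_recr/= phiD ?IH//; first exact: mUn.
  rewrite -bigcup_mkord; apply/seteqP; split => // x [[i /= ilt Fi] Fn].
  have := tF i n I I; rewrite -falseE => /(_ (ex_intro _ x (conj Fi Fn))) ie.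
  by move: ilt; rewrite ie ltnn.
set Un := \big[setU/set0]_(i < n) F i.
have UnU : Un `<=` \bigcup_i F i.
  by rewrite /Un -bigcup_mkord => x [i _ Fi]; exists i.
rewrite -(setDUK UnU) phiD ?setDIK//; last 2 first.
- exact: mUn.
- by apply: measurableD => //; exact: mUn.
by rewrite lerDl phi0//; apply: measurableD => //; exact: mUn.
Qed.

(** Both [nu] and [mu - nu] are nonnegative and additive, so [additive_sum_le] applies to each. This
    squeezes the partial sums of [nu] between the total and the total minus a tail of [mu], and the
    tail tends to 0. *)
Lemma dominated_semi_sigma_additive (mu : {finite_measure set T -> \bar R}) nu :
  (forall A, measurable A -> 0 <= nu A <= fine (mu A)) ->
  (forall A B, measurable A -> measurable B -> A `&` B = set0 ->
    nu (A `|` B) = nu A + nu B) ->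
  semi_sigma_additive (fun A => (nu A)%:E).
Proof.
move=> nu01 nuD F mF tF mU.
have muD A B : measurable A -> measurable B -> A `&` B = set0 ->
    fine (mu (A `|` B)) = fine (mu A) + fine (mu B).
  by move=> mA mB AB; rewrite measureU// fineD// fin_num_measure.
under eq_fun do rewrite sumEFin.
apply: cvg_EFin; first by apply: nearW.
have mucvg : (fun n => \sum_(0 <= i < n) fine (mu (F i))) @ \oo -->
    fine (mu (\bigcup_i F i)).
  have : (\sum_(0 <= i < n) mu (F i))%E @[n --> \oo] -->
      (fine (mu (\bigcup_i F i)))%:E.
    by rewrite fineK ?fin_num_measure//; exact: measure_semi_sigma_additive.
  move=> /fine_cvg; apply: cvg_trans; apply: near_eq_cvg; apply: nearW => n /=.
  rewrite -[RHS]/(fine (\sum_(0 <= i < n) fine (mu (F i)))%:E) -sumEFin.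
  congr fine; apply: eq_bigr => i _; rewrite fineK//.
  by rewrite fin_num_measure.
apply: (@squeeze_cvgr _ _ _ _
  (fun n => nu (\bigcup_i F i) - fine (mu (\bigcup_i F i)) +
            \sum_(0 <= i < n) fine (mu (F i)))
  (fun=> nu (\bigcup_i F i))); last 2 first.
- rewrite -[X in _ --> X](subrK (fine (mu (\bigcup_i F i)))).
  by apply: cvgD => //; exact: cvg_cst.
- exact: cvg_cst.
apply: nearW => n; apply/andP; split; last first.
  by apply: additive_sum_le => // A /nu01 /andP[].
(* The lower bound of the squeeze is the upper bound for the complementary set function
   [mu - nu]. *)
have := @additive_sum_le (fun A => fine (mu A) - nu A) F n.
rewrite /= sumrB => H.
suff : \sum_(0 <= i < n) fine (mu (F i)) - \sum_(0 <= i < n) nu (F i) <=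
  fine (mu (\bigcup_i F i)) - nu (\bigcup_i F i) by lra.
apply: H => //.
- by move=> A /nu01; rewrite subr_ge0 => /andP[].
- by move=> A B mA mB AB; rewrite muD// nuD//; lra.
Qed.

End dominated_set_function.

(** * Weak-* compactness of the functions with values in [[0, 1]] *)

Section weak_star_limit.
Context d (T : measurableType d) (R : realType).
Variables (mu : {finite_measure set T -> \bar R}) (D : set T).
Hypothesis mD : measurable D.

(** The Radon-Nikodym derivative [f] of [nu] exceeds 1 only on a null set, because [nu <= mu].
    Truncating it at 1 keeps all its integrals and makes the bounds hold everywhere. *)
Lemma dominated_density (nu : {finite_measure set T -> \bar R}) :
  (forall A, measurable A -> (nu A <= mu A)%E) ->
  exists g : T -> R, [/\ measurable_fun setT g, forall x, 0 <= g x <= 1 &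
    forall A, measurable A -> nu A = (\int[mu]_(x in A) (g x)%:E)%E].
Proof.
move=> numu.
have nuac : nu `<< mu.
  apply/null_content_dominatesP => A mA muA0; apply/eqP.
  by rewrite eq_le measure_ge0 andbT -muA0 numu.
have [f [f0 ffin intf fE]] := radon_nikodym_sigma_finite nuac.
have mf : measurable_fun setT f := measurable_int _ intf.
pose g x := Num.min 1 (fine (f x)).
have mg : measurable_fun setT g.
  by apply: measurable_minr; [exact: measurable_cst|exact: measurableT_comp].
exists g; split=> //.
  by move=> x; rewrite /g le_min ler01 ge_min lexx/= fine_ge0.
pose B := [set x | 1 < f x]%E.
have mB : measurable B.
  by rewrite -[B]setTI; exact: emeasurable_fun_o_infty.
have muB : mu B = 0%E.
  have mf1 : measurable_fun B (fun x => f x - 1)%E.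
    by apply: emeasurable_funB => //; exact: measurable_funTS.
  (* On [B] the integrand is positive, yet its integral is [nu B - mu B <= 0]; hence [B] is null. *)
  have : (\int[mu]_(x in B) `|f x - 1| = 0)%E.
    rewrite (eq_integral (fun x => f x - 1)%E); last first.
      by move=> x; rewrite inE => /ltW; rewrite -(@suber_ge0 _ 1%E)// => /gee0_abs.
    rewrite integralB//; last 2 first.
    - by apply: (integrableS measurableT).
    - by apply: finite_measure_integrable_cst.
    apply/eqP; rewrite eq_le; apply/andP; split; last first.
      rewrite sube_ge0; last by rewrite integral_cst// mul1e fin_num_measure.
      apply: ge0_le_integral => //.
      - exact: measurable_funTS.
      - by move=> x /ltW.
    rewrite -fE// integral_cst// mul1e sube_le0 numu//.
  move/(ae_eq_integral_abs _ mB mf1) => [N [mN N0 BN]].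
  apply: (subset_measure0 _ _ _ N0) => // x Bx; apply: BN => /= /(_ Bx) fx1.
  have : (0 < f x - 1)%E by rewrite (@sube_gt0 _ 1%E).
  by rewrite fx1 ltxx.
move=> A mA; rewrite fE//; apply: ge0_ae_eq_integral => //.
- exact: measurable_funTS.
- by apply: measurable_funTS; exact/measurable_EFinP.
- by move=> x _; rewrite lee_fin /g le_min ler01 fine_ge0.
- exists B; split => // x /= /not_implyP [_ fg].
  rewrite /B/= ltNge; apply/negP => f1; apply: fg.
  rewrite /g min_r ?fineK//.
  by rewrite -lee_fin fineK.
Qed.

Variables (I : Type) (U : set_system I) (UU : UltraFilter U) (r : I -> T -> R).
Hypothesis mr : forall i, measurable_fun D (r i).
Hypothesis r01 : forall i x, D x -> 0 <= r i x <= 1.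

Let br i : bounded_mfun D (r i) := bounded_mfun01 (mr i) (@r01 i).

(** The bound is the same for all densities [g], which makes the approximation of a test function
    uniform along the family [r]. *)
Lemma Rintegral_density_norm_le g f K : bounded_mfun D g ->
  (forall x, D x -> 0 <= g x <= 1) ->
  bounded_mfun D f -> (forall x, D x -> `|f x| <= K) ->
  `|\int[mu]_(x in D) (g x * f x)| <= K * fine (mu D).
Proof.
move=> bg g01 bf fK; apply: Rintegral_norm_le => //; first exact: bounded_mfunM.
move=> x Dx; have /andP[g0 g1] := g01 _ Dx.
by rewrite normrM ger0_norm// -[leRHS]mul1r ler_pM ?fK.
Qed.

(** For each measurable [A] the integrals lie between 0 and [mu A], so they converge along [U]. The
    limit is additive and dominated by [mu], hence countably additive. *)
Let ultra_measure : exists2 nu : {finite_measure set T -> \bar R},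
  forall A, measurable A -> (nu A <= mu A)%E &
  forall A, measurable A ->
    (\int[mu]_(x in D) (r i x * \1_A x)) @[i --> U] --> fine (nu A).
Proof.
have b1 A : measurable A -> bounded_mfun D (\1_A : T -> R).
  exact: bounded_mfun_indic.
have J0 i A : 0 <= \int[mu]_(x in D) (r i x * \1_A x).
  apply: Rintegral_ge0 => x Dx; have /andP[ri0 _] := r01 i Dx.
  by rewrite mulr_ge0// indicE ler0n.
have Jmu i A : measurable A ->
    \int[mu]_(x in D) (r i x * \1_A x) <= fine (mu A).
  move=> mA; apply: (@le_trans _ _ (\int[mu]_(x in D) (\1_A x))).
    apply: le_Rintegral => //.
    - by apply: bounded_mfun_integrable => //; apply: bounded_mfunM => //; exact: b1.
    - by apply: bounded_mfun_integrable => //; exact: b1.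
    - move=> x Dx; have /andP[ri0 ri1] := r01 i Dx.
      by rewrite -[leRHS]mul1r ler_wpM2r// indicE ler0n.
  rewrite /Rintegral integral_indic// fine_le ?fin_num_measure//.
  - exact: measurableI.
  - by apply: le_measure; rewrite ?inE//; exact: measurableI.
(* The choice ranges over all sets, so a nonnegative value is also supplied on non-measurable ones;
   0 serves as witness there. *)
have /choice[nu nuP] A : exists l : R, 0 <= l /\ (measurable A ->
    (\int[mu]_(x in D) (r i x * \1_A x)) @[i --> U] --> l).
  have [mA|nmA] := pselect (measurable A); last by exists 0.
  have [|l Jl] := @ultra_cvg_bounded _ _ _ UU
    (fun i => \int[mu]_(x in D) (r i x * \1_A x)) (fine (mu A)).
    by move=> i; rewrite ger0_norm// Jmu.
  exists l; split=> //.
  by apply: (cvgr_to_ge Jl); exact: nearW.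
have nu0 A : 0 <= nu A by have [] := nuP A.
have nucvg A mA := (nuP A).2 mA.
have numu A : measurable A -> nu A <= fine (mu A).
  by move=> mA; apply: (cvgr_to_le (nucvg _ mA)); apply: nearW => i; exact: Jmu.
have nuD A B : measurable A -> measurable B -> A `&` B = set0 ->
    nu (A `|` B) = nu A + nu B.
  move=> mA mB AB.
  apply: (cvg_unique _ (nucvg _ (measurableU _ _ mA mB))) => //.
  rewrite (_ : (fun i => _) = (fun i => \int[mu]_(x in D) (r i x * \1_A x) +
    \int[mu]_(x in D) (r i x * \1_B x))).
    by apply: cvgD; exact: nucvg.
  apply/funext => i; rewrite -RintegralD//; last 2 first.
  - by apply: bounded_mfun_integrable => //; apply: bounded_mfunM => //; exact: b1.
  - by apply: bounded_mfun_integrable => //; apply: bounded_mfunM => //; exact: b1.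
  apply: eq_Rintegral => x _; rewrite -mulrDr !indicE in_setU -natrD.
  case: (boolP (x \in A)) => // /set_mem Ax; rewrite (_ : x \in B = false)//.
  by apply/memNset => Bx; have : set0 x by rewrite -AB.
have nuset0 : nu set0 = 0.
  have := nuD set0 set0 measurable0 measurable0 (setI0 _).
  by rewrite setU0; lra.
pose nuE A := (nu A)%:E.
have nuE0 : nuE set0 = 0%E by rewrite /nuE nuset0.
have nuE_ge0 A : (0 <= nuE A)%E by rewrite lee_fin.
have nuEsa : semi_sigma_additive nuE.
  apply: (@dominated_semi_sigma_additive _ _ _ mu) => //.
  by move=> A mA; rewrite nu0 numu.
pose nuM := isMeasure.Build _ _ _ nuE nuE0 nuE_ge0 nuEsa.
have nuEfin : fin_num_fun nuE by [].
pose nuF := @Measure_isFinite.Build _ _ _ (HB.pack_for {measure set T -> \bar R} nuE nuM) nuEfin.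
pose nuEF : {finite_measure set T -> \bar R} := HB.pack nuE nuM nuF.
exists nuEF => A mA; last exact: nucvg.
by rewrite -[leRHS]fineK ?fin_num_measure// lee_fin numu.
Qed.

(** * From indicators to all bounded measurable test functions *)

Section uniform_approximation.
Variables (g : T -> R).
Hypothesis mg : measurable_fun D g.
Hypothesis g01 : forall x, D x -> 0 <= g x <= 1.

Let bg : bounded_mfun D g := bounded_mfun01 mg g01.

(** The test functions against which [r] converges to [g]. They are stable under linear combinations
    and uniform limits; starting from indicators, they exhaust the bounded measurable functions. *)
Let good (f : T -> R) := (\int[mu]_(x in D) (r i x * f x)) @[i --> U] -->
  \int[mu]_(x in D) (g x * f x).

Let pairD (q f1 f2 : T -> R) (c : R) : bounded_mfun D q -> bounded_mfun D f1 ->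
  bounded_mfun D f2 ->
  \int[mu]_(x in D) (q x * (c * f1 x + f2 x)) =
  c * \int[mu]_(x in D) (q x * f1 x) + \int[mu]_(x in D) (q x * f2 x).
Proof.
move=> bq b1 b2.
rewrite -RintegralZl//; last first.
  by apply: bounded_mfun_integrable => //; exact: bounded_mfunM.
rewrite -RintegralD//; last 2 first.
- apply: bounded_mfun_integrable => //; apply: bounded_mfunM.
    exact: bounded_mfun_cst.
  exact: bounded_mfunM.
- by apply: bounded_mfun_integrable => //; exact: bounded_mfunM.
by apply: eq_Rintegral => x _; ring.
Qed.

Let goodD (c : R) (f1 f2 : T -> R) : bounded_mfun D f1 -> bounded_mfun D f2 ->
  good f1 -> good f2 -> good (fun x => c * f1 x + f2 x).
Proof.
move=> b1 b2 g1 g2; rewrite /good pairD//.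
under eq_fun do rewrite pairD//.
by apply: cvgD => //; apply: cvgMr.
Qed.

Let good_unif (f : T -> R) : bounded_mfun D f ->
  (forall e, 0 < e -> exists h, [/\ bounded_mfun D h, good h &
    forall x, D x -> `|f x - h x| <= e]) -> good f.
Proof.
move=> bf fh; apply/cvgrPdist_le => e e0.
set M := fine (mu D).
have M0 : 0 <= M by rewrite fine_ge0.
have M1 : 0 < 2 * M + 1 by rewrite ltr_wpDl// mulr_ge0.
(* Replacing [f] by [h] costs [e / (2 * M + 1) * M] for [g] and again for [r i], and the convergence
   for [h] costs [e / (2 * M + 1)]; the total is [e]. The added 1 keeps the denominator positive
   when [M = 0]. *)
have [|h [bh gh hf]] := fh (e / (2 * M + 1)); first by rewrite divr_gt0.
have {}fh q : bounded_mfun D q -> (forall x, D x -> 0 <= q x <= 1) ->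
    `|\int[mu]_(x in D) (q x * f x) - \int[mu]_(x in D) (q x * h x)| <=
    e / (2 * M + 1) * M.
  move=> bq q01; rewrite -RintegralB//; last 2 first.
  - by apply: bounded_mfun_integrable => //; exact: bounded_mfunM.
  - by apply: bounded_mfun_integrable => //; exact: bounded_mfunM.
  under eq_Rintegral do rewrite -mulrBr.
  apply: Rintegral_density_norm_le => //.
  under eq_fun do rewrite -mulN1r; apply: bounded_mfunD => //.
  by apply: bounded_mfunM => //; exact: bounded_mfun_cst.
have e1 : 0 < e / (2 * M + 1) by rewrite divr_gt0.
have eE : e = e / (2 * M + 1) * M + e / (2 * M + 1) + e / (2 * M + 1) * M.
  by field; rewrite gt_eqF.
move/cvgrPdist_le : gh => /(_ _ e1); apply: filterS => i gh.
have := fh _ bg g01; have := fh _ (br i) (@r01 i).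
move: gh; rewrite !ler_norml => /andP[? ?] /andP[? ?] /andP[? ?].
by apply/andP; split; lra.
Qed.

Hypothesis good_indic : forall A, measurable A -> good (\1_A).

(* Subtracting [c / 2] where [f >= c / 2] halves the bound on [f]. *)
Let good_dyadic (p : nat) (c : R) (f : T -> R) : 0 < c -> measurable_fun setT f ->
  (forall x, 0 <= f x <= c) ->
  exists h, [/\ bounded_mfun D h, good h &
    forall x, D x -> `|f x - h x| <= c / 2 ^+ p].
Proof.
elim: p c f => [|p IH] c f c0 mf f0c.
  exists (fun=> 0); split; first exact: bounded_mfun_cst.
  - rewrite /good; under eq_fun do under eq_Rintegral do rewrite mulr0.
    under eq_Rintegral do rewrite mulr0; exact: cvg_cst.
  - by move=> x _; have /andP[f0 fc] := f0c x; rewrite subr0 divr1 ger0_norm.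
pose A := [set x | c / 2 <= f x].
have mA : measurable A.
  rewrite -[A]setTI; have := mf measurableT `[c / 2, +oo[%classic.
  rewrite (_ : _ @^-1` _ = A); first by apply.
  by apply/seteqP; split=> x /=; rewrite in_itv/= andbT.
pose f' x := f x - c / 2 * \1_A x.
have [|||h [bh gh hf]] := IH (c / 2) f'.
- by rewrite divr_gt0.
- by apply: measurable_funB => //; apply: measurable_funM.
- move=> x; rewrite /f' indicE; have /andP[f0 fc] := f0c x.
  have [/set_mem Ax|/negP] := boolP (x \in A).
    by rewrite mulr1; move: Ax; rewrite /A/= => ?; apply/andP; split; lra.
  rewrite inE /A/= => /negP; rewrite -ltNge => ?.
  by rewrite mulr0; apply/andP; split; lra.
exists (fun x => c / 2 * \1_A x + h x).
have bA : bounded_mfun D (\1_A : T -> R) by exact: bounded_mfun_indic.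
split.
- by apply: bounded_mfunD => //; apply: bounded_mfunM => //; exact: bounded_mfun_cst.
- by apply: goodD => //; exact: good_indic.
- move=> x Dx; have := hf x Dx; rewrite /f' exprS invfM mulrA.
  by rewrite opprD addrA.
Qed.

(** After extension by 0 and a shift by [L], the function takes values in [[0, 2 * L]], where the
    dyadic approximation applies; the shift is undone with the indicator of the whole space. *)
Lemma weak_star_cvg (f : T -> R) : bounded_mfun D f -> good f.
Proof.
move=> [mf [K fK]].
(* [K] may be 0, or negative if [D] is empty, while the dyadic approximation needs a positive
   range. *)
pose L := `|K| + 1.
have L0 : 0 < L by rewrite ltr_wpDl.
pose f1 := (f \_ D).
have mf1 : measurable_fun setT f1.
  exact/(measurable_restrictT _ mD).
have f1L x : `|f1 x| <= L.
  rewrite /f1 patchE; case: ifPn => [/set_mem Dx|_]; last by rewrite normr0 ltW.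
  by rewrite (le_trans (fK _ Dx))// /L (le_trans (ler_norm _))// lerDl.
apply: good_unif; first by split=> //; exists K.
move=> e e0.
have [p pe] : exists p, 2 * L / 2 ^+ p <= e.
  have := archi_boundP (ltW (divr_gt0 (mulr_gt0 (ltr0Sn R 1) L0) e0)).
  set p := Num.Def.archi_bound _ => pL; exists p.
  rewrite ler_pdivrMr ?exprn_gt0// [leRHS]mulrC -ler_pdivrMr//.
  rewrite (le_trans (ltW pL))// -natrX ler_nat ltnW// ltn_expl//.
have [|||h [bh gh hf]] := good_dyadic p (c := 2 * L) (f := fun x => f1 x + L).
- by rewrite mulr_gt0.
- exact: measurable_funD.
- move=> x; have := f1L x; rewrite ler_norml => /andP[? ?].
  by apply/andP; split; lra.
exists (fun x => (- L) * \1_setT x + h x).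
have bT : bounded_mfun D (\1_setT : T -> R) by exact: bounded_mfun_indic.
split.
- by apply: bounded_mfunD => //; apply: bounded_mfunM => //; exact: bounded_mfun_cst.
- by apply: goodD => //; exact: good_indic.
- move=> x Dx; rewrite (le_trans _ pe)//; have := hf x Dx.
  rewrite /f1 patchE mem_set//= indicT mulr1.
  by congr (`|_| <= _); rewrite /cst; ring.
Qed.

End uniform_approximation.

Lemma weak_star_compact : exists g : T -> R,
  [/\ measurable_fun setT g, forall x, 0 <= g x <= 1 &
   forall f, bounded_mfun D f ->
    (\int[mu]_(x in D) (r i x * f x)) @[i --> U] -->
    \int[mu]_(x in D) (g x * f x)].
Proof.
have [nu numu nucvg] := ultra_measure.
have [g [mg g01 gE]] := dominated_density numu.
exists g; split=> //; apply: weak_star_cvg => //.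
  exact: measurable_funTS.
(* The limit measure lives on all of [T] while the integrals run over [D]; evaluating it at the
   intersection with [D] reconciles the two. *)
move=> A mA; have mDA : measurable (D `&` A) by exact: measurableI.
have := nucvg _ mDA; rewrite gE// -/(Rintegral mu (D `&` A) g).
have indicDA (q : T -> R) B : \int[mu]_(x in D) (q x * \1_B x) =
    \int[mu]_(x in D `&` B) q x.
  rewrite Rintegral_mkcondr; apply: eq_Rintegral => x _.
  by rewrite patchE indicE; case: ifPn; rewrite ?mulr1 ?mulr0.
rewrite indicDA; apply: cvg_trans; apply: near_eq_cvg; apply: nearW => i /=.
by rewrite !indicDA setIA setIid.
Qed.

End weak_star_limit.

Lemma cvg_sumr (R : realType) (I J : Type) (s : seq J) (F : set_system I)
    {FF : Filter F} (f : J -> I -> R) (l : J -> R) :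
  (forall j, f j @ F --> l j) ->
  (fun i => \sum_(j <- s) f j i) @ F --> \sum_(j <- s) l j.
Proof.
move=> fl; elim: s => [|j s IH].
  under eq_fun do rewrite big_nil; rewrite big_nil; exact: cvg_cst.
under eq_fun do rewrite big_cons; rewrite big_cons; exact: cvgD.
Qed.

(** * Finiteness of the surface measure, Borel sets and compactness of the sphere *)

Section ambient_space.
Context (R : realType).

Definition unit_box n : set 'rV[R]_n := [set x | forall i, `|x ord0 i| <= 1].

Lemma measurable_unit_box n : measurable (@unit_box n).
Proof.
rewrite (_ : @unit_box n = \bigcap_(i in [set: 'I_n])
    (@rV_coord R n i @^-1` `[-1, 1]%classic)).
  apply: fin_bigcap_measurable; first exact: finite_finset.
  by move=> i _; rewrite -[X in measurable X]setTI; exact: measurable_rV_coord.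
apply/seteqP; split => [x xb i _|x xb i] /=.
  by rewrite in_itv/= -ler_norml; exact: xb.
by have := xb i I; rewrite /= in_itv/= -ler_norml.
Qed.

(** The preimage of the box under [rV_cons] is the product of [[-1, 1]] and the box of one dimension
    less, so finiteness follows by induction. *)
Lemma lebesgue_rV_unit_box n : (@lebesgue_rV R n (@unit_box n) < +oo)%E.
Proof.
elim: n => [|n IH].
  rewrite /= diracE; case: (_ \in _); exact: ltry.
rewrite /= /cons_measure /pushforward.
rewrite (_ : _ @^-1` _ = `[-1, 1]%classic `*` @unit_box n).
  rewrite product_measure1E//; last exact: measurable_unit_box.
  rewrite lte_mul_pinfty// -[X in X \is a _]/(lebesgue_measure `[-1, 1]%classic).
  by rewrite lebesgue_measure_itv/=; case: ifP.
apply/seteqP; split => [[t y] /= h|[t y] /= [ht hy] i].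
  split; first by have := h ord0; rewrite mxE unlift_none/= in_itv/= ler_norml.
  by move=> i; have := h (lift ord0 i); rewrite mxE liftK.
rewrite mxE; case: (unliftP ord0 i) => [j|] _ /=; first exact: hy.
by move: ht; rewrite in_itv/= ler_norml.
Qed.

Lemma coord_le_enorm n (x : 'rV[R]_n) i : `|x ord0 i| <= enorm x.
Proof.
rewrite -sqrtr_sqr /enorm ler_wsqrtr// /dotrV (bigD1 i)//= -expr2 lerDl.
by apply: sumr_ge0 => j _; rewrite -expr2 sqr_ge0.
Qed.

(** The cone measure of the whole space is the Lebesgue measure of the punctured ball, which lies in
    the unit box. *)
Lemma surface_measure_fin_num n : fin_num_fun (@surface_measure R n).
Proof.
move=> A mA; rewrite ge0_fin_numE//.
apply: (@le_lt_trans _ _ (@surface_measure R n setT)).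
  by apply: le_measure; rewrite ?inE//; exact: measurableT.
have cfin : (@cone_measure R n setT < +oo)%E.
  rewrite /cone_measure preimage_setT setTI.
  apply: le_lt_trans (lebesgue_rV_unit_box n.+1).
  apply: le_measure; rewrite ?inE.
  - exact: measurable_punctured_ball.
  - exact: measurable_unit_box.
  - by move=> x /andP[_ x1] i; rewrite (le_trans (coord_le_enorm _ _)).
rewrite /surface_measure /mscale; exact: lte_mul_pinfty.
Qed.

HB.instance Definition _ n := Measure_isFinite.Build _ _ _
  (@surface_measure R n) (@surface_measure_fin_num n).

Lemma measurable_sphere n : measurable (@sphere R n).
Proof.
rewrite (_ : @sphere R n = @enorm R n.+1 @^-1` [set 1]).
  rewrite -[X in measurable X]setTI; exact: measurable_enorm.
by apply/seteqP; split => x.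
Qed.

Lemma rat_vector_near n (x : 'rV[R]_n) (e : R) : 0 < e ->
  exists q : 'rV[rat]_n, ball x e (map_mx ratr q).
Proof.
move=> e0.
have /choice[q xq] i : exists q : rat, `|x ord0 i - ratr q| < e.
  have [q] := @rat_in_itvoo R (x ord0 i - e) (x ord0 i + e) ltac:(lra).
  by rewrite in_itv/= => /andP[? ?]; exists q; rewrite ltr_norml; apply/andP; split; lra.
exists (\row_i q i); split=> // i j; rewrite !mxE ord1.
exact: xq.
Qed.

Lemma measurable_ball_rV n (x : 'rV[R]_n) (e : R) : measurable (ball x e).
Proof.
have [e0|e0] := ltP 0 e; last first.
  by rewrite (_ : ball x e = set0)//; apply/seteqP; split=> // y []; rewrite ltNge e0.
rewrite (_ : ball x e = \bigcap_(i in [set: 'I_n])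
    (@rV_coord R n i @^-1` (ball (x ord0 i) e))).
  apply: fin_bigcap_measurable; first exact: finite_finset.
  move=> i _; rewrite -[X in measurable X]setTI; apply: measurable_rV_coord => //.
  exact: measurable_ball.
apply/seteqP; split => [y [_ xy] i _|y xy]; first exact: xy.
by split=> // i j; rewrite ord1; exact: xy.
Qed.

(** The sigma-algebra is generated by coordinates, whereas open sets come from the sup norm. Balls
    with rational centres and radii [N.+1%:R^-1] link the two: they are products of intervals, and
    [O] is the countable union of those it contains. *)
Lemma open_measurable_rV n (O : set 'rV[R]_n) : open O -> measurable O.
Proof.
move=> oO.
pose rb (p : 'rV[rat]_n * nat) : set 'rV[R]_n :=
  ball (map_mx ratr p.1 : 'rV[R]_n) p.2.+1%:R^-1.
rewrite (_ : O = \bigcup_p (if `[< rb p `<=` O >] then rb p else set0)).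
  apply: countable_bigcupT_measurable => // p.
  by case: asboolP => _ //; exact: measurable_ball_rV.
apply/seteqP; split => [x Ox|x [p _]]; last first.
  by case: asboolP => // sub /sub.
have /nbhs_ballP[e /= e0 xO] : nbhs x O by exact: open_nbhs_nbhs.
(* With a radius below [e / 2], a ball whose centre is that close to [x] contains [x] and stays
   within distance [e] of it. *)
have [N Ne] : exists N, N.+1%:R^-1 < e / 2.
  have e20 : 0 < e / 2 by rewrite divr_gt0.
  have := ltr_add_invr (y := 0) (x := e / 2) e20.
  by move=> [N]; rewrite add0r; exists N.
have [|q xq] := @rat_vector_near n x N.+1%:R^-1; first by rewrite invr_gt0.
exists (q, N) => //=; case: asboolP => [_|nO]; first exact: ball_sym.
exfalso; apply: nO => y qy; apply: xO.
apply: (@le_ball _ _ _ (N.+1%:R^-1 + N.+1%:R^-1)); first by rewrite [leRHS]splitr lerD// ltW.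
exact: ball_triangle xq qy.
Qed.

Lemma continuous_measurable_rV n (O : set 'rV[R]_n) (f : 'rV[R]_n -> R) :
  open O -> (forall x, O x -> {for x, continuous f}) -> measurable_fun O f.
Proof.
move=> oO cf; apply: (measurability _ (RGenOpens.measurableE R)) => //.
move=> _ [B [a [b ->]] <-]; apply: open_measurable_rV.
rewrite openE => x [Ox Bfx]; apply: filterI.
  exact: open_nbhs_nbhs.
by apply: cf => //; exact: open_nbhs_nbhs.
Qed.

Lemma compact_sphere n : compact (@sphere R n).
Proof.
apply: bounded_closed_compact.
  exists 1; split; first exact: num_real.
  move=> M M1 x Sx; rewrite /= [leLHS]mx_normrE; apply/bigmax_leP; split.
    by rewrite (le_trans _ (ltW M1)).
  move=> [i j] _ /=; rewrite ord1 (le_trans (coord_le_enorm _ _))// Sx.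
  exact: ltW.
(* Closedness is read off the polynomial equation [dotrV x x = 1], whose left side is continuous
   coordinate by coordinate. *)
rewrite (_ : @sphere R n = (fun x => dotrV x x) @^-1` [set 1]).
  apply: closed_comp => [x _|]; last exact: closed_eq.
  apply: (@cvg_sumr R _ _ _ (nbhs x) _
    (fun i (y : 'rV[R]_n.+1) => y ord0 i * y ord0 i)) => i.
  have cx := @coord_continuous R 1 n.+1 ord0 i x; exact: (cvgM cx cx).
apply/seteqP; split => x; rewrite /sphere/= /enorm => x1.
  by rewrite -[LHS]sqr_sqrtr ?x1 ?expr1n// sumr_ge0// => i _; rewrite -expr2 sqr_ge0.
by rewrite x1 sqrtr1.
Qed.

Lemma sphere_neq0 n (x : 'rV[R]_n.+1) : sphere x -> x != 0.
Proof.
move=> Sx; apply/eqP => x0; move: Sx; rewrite /sphere/= x0 /enorm /dotrV.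
rewrite big1 ?sqrtr0; first by move/eqP; rewrite eq_sym oner_eq0.
by move=> i _; rewrite mxE mul0r.
Qed.

(** Measurability comes from the open punctured space, boundedness from compactness of the sphere.
    The origin is excluded because functions composed with [radial] are regular only away from
    it. *)
Lemma continuous_bounded_mfun_sphere n (f : 'rV[R]_n.+1 -> R) :
  (forall x, x != 0 -> {for x, continuous f}) -> bounded_mfun (@sphere R n) f.
Proof.
move=> cf.
pose O : set 'rV[R]_n.+1 := [set x | x != 0].
have oO : open O.
  rewrite (_ : O = ~` [set 0]); last by apply/seteqP; split=> x /= /eqP.
  by apply/closed_openC/accessible_closed_set1/hausdorff_accessible/norm_hausdorff.
split.
  apply: (@measurable_funS _ _ _ _ O) (@continuous_measurable_rV _ _ _ oO cf).
    exact: open_measurable_rV.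
  by move=> x /sphere_neq0.
have : compact (f @` @sphere R n).
  apply: continuous_compact; last exact: compact_sphere.
  apply: continuous_in_subspaceT => x; rewrite inE => /sphere_neq0; exact: cf.
move=> /compact_bounded[M [_ fM]]; exists (M + 1) => x Sx.
by apply: fM; [rewrite ltrDl|exists x].
Qed.

End ambient_space.

(** * Quadratic forms and the openness of positive definiteness *)

Section quadratic_form.
Context (R : realType) (d : nat).

Definition qform (Q : 'I_d -> 'I_d -> R) (c : 'I_d -> R) : R :=
  \sum_i \sum_j c i * c j * Q i j.

Lemma qformZ Q (a : R) c : qform Q (fun i => a * c i) = a ^+ 2 * qform Q c.
Proof.
rewrite /qform mulr_sumr; apply: eq_bigr => i _.
by rewrite mulr_sumr; apply: eq_bigr => j _; ring.
Qed.

Lemma qform_continuous Q :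
  continuous (fun x : 'rV[R]_d => qform Q (fun i => x ord0 i)).
Proof.
move=> x; apply: (@cvg_sumr R _ _ _ (nbhs x) _
  (fun i (y : 'rV[R]_d) => \sum_j y ord0 i * y ord0 j * Q i j)) => i.
apply: (@cvg_sumr R _ _ _ (nbhs x) _
  (fun j (y : 'rV[R]_d) => y ord0 i * y ord0 j * Q i j)) => j.
have ci := @coord_continuous R 1 d ord0 i x.
have cj := @coord_continuous R 1 d ord0 j x.
exact: (cvgM (cvgM ci cj) (cvg_cst (Q i j))).
Qed.

Lemma qform_dist_le Q Q' (c : 'I_d -> R) (e : R) :
  (forall i, `|c i| <= 1) -> (forall i j, `|Q i j - Q' i j| <= e) ->
  `|qform Q c - qform Q' c| <= d%:R * d%:R * e.
Proof.
move=> c1 QQ'; rewrite /qform -sumrB.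
under eq_bigr do rewrite -sumrB.
rewrite (le_trans (ler_norm_sum _ _ _))//.
rewrite (_ : d%:R * d%:R * e = \sum_(i < d) \sum_(j < d) e); last first.
  by rewrite !sumr_const card_ord -mulrnA -[RHS]mulr_natl natrM.
apply: ler_sum => i _; rewrite (le_trans (ler_norm_sum _ _ _))//.
apply: ler_sum => j _; rewrite -mulrBr !normrM -[leRHS]mul1r ler_pM//.
by rewrite -[leRHS]mul1r ler_pM.
Qed.

(** On the compact unit sphere of the sup norm, [Q0] has a positive minimum [del]. Once all
    coefficients are close enough the form stays positive there, and homogeneity extends this to
    every nonzero [c]. *)
Lemma qform_gt0_near (I : Type) (U : set_system I) {FU : Filter U}
    (Q : I -> 'I_d -> 'I_d -> R) Q0 :
  (forall i j, (fun t => Q t i j) @ U --> Q0 i j) ->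
  (forall c, (exists i, c i != 0) -> 0 < qform Q0 c) ->
  \forall t \near U, forall c, (exists i, c i != 0) -> 0 < qform (Q t) c.
Proof.
move=> QQ0 Q0gt0.
(* In dimension 0 the claim is vacuous, while the minimum below needs a nonempty unit sphere. *)
have [d0|dgt0] := posnP d.
  by apply: nearW => t c [i]; exfalso; move: i; rewrite d0 => -[].
pose K := [set x : 'rV[R]_d | `|x| = 1].
have cK : compact K.
  apply: bounded_closed_compact.
    exists 1; split; first exact: num_real.
    by move=> M M1 x /= ->; exact: ltW.
  rewrite (_ : K = (fun x => `|x|) @^-1` [set 1]); last by [].
  by apply: closed_comp => [x _|]; [exact: norm_continuous|exact: closed_eq].
have K0 : K !=set0.
  exists (const_mx 1); rewrite /K/=; apply/le_anti/andP; split.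
    by rewrite [leLHS]mx_normrE; apply/bigmax_leP; split=> // i _; rewrite mxE normr1.
  rewrite [leRHS]mx_normrE; apply/bigmax_geP; right.
  exists (ord0, Ordinal dgt0) => //=.
  by rewrite mxE normr1.
have [x0 /set_mem Kx0 minx0] : exists2 x0, x0 \in K & forall x, x \in K ->
    qform Q0 (fun i => x0 ord0 i) <= qform Q0 (fun i => x ord0 i).
  apply: (compact_EVT_min (f := fun x : 'rV[R]_d => qform Q0 (fun i => x ord0 i))) => //.
  by apply: continuous_subspaceT => x; exact: qform_continuous.
set del := qform Q0 _ in minx0.
have nz (x : 'rV[R]_d) : x != 0 -> exists i, x ord0 i != 0.
  move=> x0'; apply/not_existsP => H; move/eqP: x0'; apply; apply/rowP => i.
  by rewrite mxE; apply/eqP/negPn/negP => /H.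
have del0 : 0 < del.
  apply: Q0gt0; apply: nz; rewrite -normr_eq0 Kx0; exact: oner_neq0.
(* The [d * d] coefficients change the form by at most [d * d * e] on the unit sphere, which leaves
   at least [del - d * d * e = e > 0]. *)
pose e := del / (d%:R * d%:R + 1).
have d1 : 0 < d%:R * d%:R + 1 :> R by rewrite ltr_wpDl// mulr_ge0.
have e0 : 0 < e by rewrite divr_gt0.
have : \forall t \near U, forall i j, `|Q t i j - Q0 i j| <= e.
  apply: filter_forall => i; apply: filter_forall => j.
  by have /cvgrPdistC_le := QQ0 i j; exact.
apply: filterS => t Qt c [i ci].
pose x := \row_i c i.
have x0' : 0 < `|x|.
  rewrite normr_gt0; apply/eqP => /rowP /(_ i); rewrite !mxE => ci0.
  by rewrite ci0 eqxx in ci.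
pose y := `|x|^-1 *: x.
have Ky : K y by rewrite /K/= normrZ ger0_norm ?invr_ge0// mulVf// gt_eqF.
have y1 j : `|y ord0 j| <= 1.
  rewrite -[leRHS]Ky [leRHS]mx_normrE; apply/bigmax_geP; right.
  by exists (ord0, j).
have := qform_dist_le y1 Qt; have := minx0 y (mem_set Ky).
have -> : qform (Q t) c = `|x| ^+ 2 * qform (Q t) (fun i => y ord0 i).
  rewrite -qformZ; congr qform; apply/funext => j; rewrite !mxE mulrA.
  by rewrite divff ?mul1r// gt_eqF.
move=> dely; rewrite ler_norml => /andP[Qy _].
have ee : e * (d%:R * d%:R + 1) = del by rewrite divfK// gt_eqF.
rewrite mulr_gt0 ?exprn_gt0//; move: Qy dely e0; rewrite -ee.
by rewrite mulrDr mulr1 [e * _]mulrC; lra.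
Qed.

End quadratic_form.

(** * Numerator and denominator of the Rayleigh quotient as quadratic forms *)

Section rayleigh_forms.
Context (R : realType) (n : nat).
Local Notation V := 'rV[R]_n.+1.
Local Notation S := (@sphere R n).
Local Notation sigma := (@surface_measure R n).

Let mS : measurable S := @measurable_sphere R n.

Lemma bounded_mfun_eq (f g : V -> R) :
  (forall x, S x -> f x = g x) -> bounded_mfun S f -> bounded_mfun S g.
Proof.
move=> fg [mf [K fK]]; split; last by exists K => x Sx; rewrite -fg// fK.
by apply: eq_measurable_fun mf => x /set_mem; exact: fg.
Qed.

Lemma radial_id (x : V) : S x -> radial x = x.
Proof. by move=> Sx; rewrite /radial Sx invr1 scale1r. Qed.

(** Off the sphere [u] is arbitrary; the continuous function is [u \o radial], which agrees with [u]
    on the sphere. *)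
Lemma smooth_sphere_bounded (u : V -> R) : smooth_sphere u -> bounded_mfun S u.
Proof.
move=> /(_ 0%N) su; apply: (@bounded_mfun_eq (u \o @radial R n.+1)).
  by move=> x Sx /=; rewrite radial_id.
exact: continuous_bounded_mfun_sphere.
Qed.

Lemma smooth_sphere_partial_bounded (u : V -> R) (i : 'I_n.+1) :
  smooth_sphere u -> bounded_mfun S (fun x => sphere_grad u x ord0 i).
Proof.
move=> /(_ 1%N)[_ /(_ i) su].
apply: (@bounded_mfun_eq (partial i (u \o @radial R n.+1))).
  by move=> x Sx; rewrite mxE.
exact: continuous_bounded_mfun_sphere.
Qed.

Lemma sphere_grad_lincomb d (u : 'I_d -> V -> R) (c : 'I_d -> R) (x : V)
    (l : 'I_n.+1) :
  (forall i, smooth_sphere (u i)) -> S x ->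
  sphere_grad (lincomb u c) x ord0 l = \sum_i c i * sphere_grad (u i) x ord0 l.
Proof.
move=> su Sx; rewrite mxE /partial.
have du i : derivable (u i \o @radial R n.+1) x (delta_mx ord0 l).
  by apply: diff_derivable; have [+ _] := su i 1%N; apply; exact: sphere_neq0 Sx.
rewrite (_ : _ \o _ = \sum_(i < d) (c i \*: (u i \o @radial R n.+1))); last first.
  by apply/funext => y; rewrite fct_sumE.
rewrite derive_sum; last by move=> i; exact: derivableZ.
by apply: eq_bigr => i _; rewrite deriveZ// mxE.
Qed.

(** The polarized gradient term; integrated against the density it gives the entries of the
    stiffness matrix. *)
Definition grad_dot (u v : V -> R) (x : V) : R :=
  dotrV (sphere_grad u x) (sphere_grad v x).

Lemma grad_dot_bounded u v : smooth_sphere u -> smooth_sphere v ->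
  bounded_mfun S (grad_dot u v).
Proof.
move=> su sv; apply: bounded_mfun_sum => i.
by apply: bounded_mfunM; exact: smooth_sphere_partial_bounded.
Qed.

Lemma enorm_sqr k (x : 'rV[R]_k) : enorm x ^+ 2 = dotrV x x.
Proof. by rewrite sqr_sqrtr// sumr_ge0// => i _; rewrite -expr2 sqr_ge0. Qed.

(** By linearity the density enters only through finitely many integrals against fixed test
    functions, and these are what weak-* convergence controls. *)
Lemma Rintegral_qform d (rho : V -> R) (K : 'I_d -> 'I_d -> V -> R)
    (c : 'I_d -> R) :
  bounded_mfun S rho -> (forall i j, bounded_mfun S (K i j)) ->
  \int[sigma]_(x in S) (rho x * qform (fun i j => K i j x) c) =
  qform (fun i j => \int[sigma]_(x in S) (rho x * K i j x)) c.
Proof.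
move=> brho bK.
have brK i j : bounded_mfun S (fun x => c i * c j * (rho x * K i j x)).
  by apply: bounded_mfunM; [exact: bounded_mfun_cst|exact: bounded_mfunM].
transitivity (\int[sigma]_(x in S)
    (\sum_i \sum_j c i * c j * (rho x * K i j x))).
  apply: eq_Rintegral => x _; rewrite mulr_sumr; apply: eq_bigr => i _.
  by rewrite mulr_sumr; apply: eq_bigr => j _; ring.
rewrite Rintegral_sum//; last by move=> i; exact: bounded_mfun_sum.
apply: eq_bigr => i _; rewrite Rintegral_sum//; apply: eq_bigr => j _.
by rewrite RintegralZl//; apply: bounded_mfun_integrable => //; exact: bounded_mfunM.
Qed.

Lemma Rintegral_lincomb_sqr d (rho : V -> R) (u : 'I_d -> V -> R) c :
  bounded_mfun S rho -> (forall i, smooth_sphere (u i)) ->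
  \int[sigma]_(x in S) (rho x * lincomb u c x ^+ 2) =
  qform (fun i j => \int[sigma]_(x in S) (rho x * (u i x * u j x))) c.
Proof.
move=> brho su; rewrite -Rintegral_qform//; last first.
  by move=> i j; apply: bounded_mfunM; exact: smooth_sphere_bounded.
apply: eq_Rintegral => x _; congr (_ * _).
rewrite /lincomb expr2 mulr_suml; apply: eq_bigr => i _.
by rewrite mulr_sumr; apply: eq_bigr => j _; ring.
Qed.

Lemma Rintegral_grad_lincomb_sqr d (rho : V -> R) (u : 'I_d -> V -> R) c :
  bounded_mfun S rho -> (forall i, smooth_sphere (u i)) ->
  \int[sigma]_(x in S) (rho x * enorm (sphere_grad (lincomb u c) x) ^+ 2) =
  qform (fun i j => \int[sigma]_(x in S) (rho x * grad_dot (u i) (u j) x)) c.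
Proof.
move=> brho su; rewrite -Rintegral_qform//; last first.
  by move=> i j; exact: grad_dot_bounded.
apply: eq_Rintegral => x /set_mem Sx; congr (_ * _).
rewrite enorm_sqr /dotrV.
under eq_bigr do rewrite sphere_grad_lincomb//.
rewrite /qform /grad_dot /dotrV.
under [RHS]eq_bigr do under eq_bigr do rewrite mulr_sumr.
under [RHS]eq_bigr do rewrite exchange_big/=.
rewrite [RHS]exchange_big/=; apply: eq_bigr => l _.
rewrite mulr_suml; apply: eq_bigr => i _.
by rewrite mulr_sumr; apply: eq_bigr => j _; ring.
Qed.

(** The integrand is nonnegative, so its integral vanishes iff it is 0 almost everywhere, that is,
    iff [v] is 0 almost everywhere where [rho > 0]. This identifies independence of test functions
    with positive definiteness of the mass form. *)
Lemma eq_on_support_Rintegral (rho v : V -> R) :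
  measurable_fun S rho -> (forall x, S x -> 0 <= rho x <= 1) ->
  bounded_mfun S v ->
  eq_on_support rho v (cst 0) <->
  \int[sigma]_(x in S) (rho x * v x ^+ 2) = 0.
Proof.
move=> mrho rho01 bv.
have bf : bounded_mfun S (fun x => rho x * v x ^+ 2).
  apply: bounded_mfunM; first exact: bounded_mfun01.
  exact: bounded_mfunM.
have intf := bounded_mfun_integrable sigma mS bf.
have f0 x : S x -> 0 <= rho x * v x ^+ 2.
  by move=> Sx; have /andP[? _] := rho01 _ Sx; rewrite mulr_ge0// sqr_ge0.
have ae0 : \int[sigma]_(x in S) (rho x * v x ^+ 2) = 0 <->
    ae_eq sigma S (fun x => (rho x * v x ^+ 2)%:E) (cst 0%E).
  rewrite -ae_eq_integral_abs//; last exact: measurable_int intf.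
  rewrite (eq_integral (fun x => (rho x * v x ^+ 2)%:E)); last first.
    by move=> x /set_mem Sx; rewrite gee0_abs// lee_fin f0.
  split=> [f00|f00]; last by rewrite /Rintegral f00.
  rewrite -[LHS]fineK; last exact: integrable_fin_num.
  by rewrite -[fine _]/(\int[sigma]_(x in S) (rho x * v x ^+ 2)) f00.
rewrite ae0; split; apply: filterS => x.
  move=> sv Sx /=; have := rho01 x Sx; rewrite le_eqVlt => /andP[/orP[/eqP<-|r0] _].
    by rewrite mul0r.
  by rewrite sv// expr0n/= mulr0.
move=> sv Sx r0; have /eqP := sv Sx; rewrite /= eqe mulf_eq0 gt_eqF//=.
by rewrite sqrf_eq0 => /eqP.
Qed.

End rayleigh_forms.

Lemma lte_real_between (R : realType) (x y : \bar R) :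
  (x < y)%E -> exists c : R, (x < c%:E < y)%E.
Proof.
case: x y => [x| |] [y| |]//; rewrite ?lte_fin => xy.
- by exists ((x + y) / 2); rewrite !lte_fin; apply/andP; split; lra.
- by exists (x + 1); rewrite lte_fin ltrDl ltr01 ltry.
- by exists (y - 1); rewrite lte_fin ltrBlDr ltrDl ltr01 ltNyr.
- by exists 0; rewrite ltNyr ltry.
Qed.

(** * Upper semicontinuity of the eigenvalue along a filter *)

Section upper_semicontinuity.
Context (R : realType) (n : nat).
Local Notation V := 'rV[R]_n.+1.
Local Notation S := (@sphere R n).
Local Notation sigma := (@surface_measure R n).

Lemma densities_nonempty (m : R) :
  0 <= m -> (m%:E <= sigma S)%E -> @densities R n m !=set0.
Proof.
move=> m0 mS.
have Sfin : sigma S \is a fin_num.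
  by apply: surface_measure_fin_num; exact: measurable_sphere.
have [s0 sE] : 0 <= fine (sigma S) /\ sigma S = (fine (sigma S))%:E.
  by rewrite fine_ge0// fineK.
have ms : m <= fine (sigma S) by rewrite -lee_fin -sE.
(* The constant density of mass [m]. Were the sphere null, the quotient would be 0 by convention and
   [m] would be 0 too. *)
exists (fun=> m / fine (sigma S)); split; first exact: measurable_cst.
  move=> x _; rewrite divr_ge0//=; move: s0; rewrite le_eqVlt => /orP[/eqP<-|s0].
    by rewrite invr0 mulr0.
  by rewrite ler_pdivrMr// mul1r.
rewrite integral_cst; last exact: measurable_sphere.
rewrite [X in (_ * X)%E]sE -EFinM; congr EFin.
move: s0; rewrite le_eqVlt => /orP[/eqP s0|s0]; last by rewrite divfK// gt_eqF.
by rewrite -s0 mulr0; apply/eqP; rewrite eq_le m0 s0 ms.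
Qed.

(** Real thresholds [c] below [s] treat finite and infinite [s] alike. A test space of [g] with
    supremum below some [c < s] would, for a suitable index [t], give a test space of [r t] with
    supremum at most [c]. *)
Lemma neumann_eigenvalue_limit (I : Type) (U : set_system I)
    (UU : ProperFilter U) (r : I -> V -> R) (g : V -> R) (k : nat) (s : \bar R) :
  (forall i, measurable_fun S (r i)) ->
  (forall i x, S x -> 0 <= r i x <= 1) ->
  measurable_fun S g -> (forall x, S x -> 0 <= g x <= 1) ->
  (forall f, bounded_mfun S f ->
    (\int[sigma]_(x in S) (r i x * f x)) @[i --> U] -->
    \int[sigma]_(x in S) (g x * f x)) ->
  (forall c : R, (c%:E < s)%E ->
    \forall i \near U, (c%:E < neumann_eigenvalue k (r i))%E) ->
  (s <= neumann_eigenvalue k g)%E.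
Proof.
move=> mr r01 mg g01 rg rs.
have br i : bounded_mfun S (r i) by apply: bounded_mfun01; [exact: mr|exact: r01].
have bg : bounded_mfun S g by exact: bounded_mfun01.
apply: le_ereal_inf_tmp => _ [W [u [su indu ->]] <-].
rewrite leNgt; apply/negP => /lte_real_between[c /andP[Mc cs]].
pose B (q : V -> R) i j := \int[sigma]_(x in S) (q x * (u i x * u j x)).
pose A (q : V -> R) i j :=
  \int[sigma]_(x in S) (q x * grad_dot (u i) (u j) x).
have bu i : bounded_mfun S (u i) by exact: smooth_sphere_bounded.
have bl a : bounded_mfun S (lincomb u a).
  apply: bounded_mfun_sum => i; apply: bounded_mfunM => //.
  exact: bounded_mfun_cst.
have lincomb_neq0 a : lincomb u a <> cst 0 -> exists i, a i != 0.
  move=> ua; apply: contrapT => a0; apply: ua; apply/funext => x.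
  rewrite /lincomb big1// => i _; have [->|ai] := eqVneq (a i) 0.
    by rewrite mul0r.
  by exfalso; apply: a0; exists i.
have Bge0 q a : bounded_mfun S q -> (forall x, S x -> 0 <= q x <= 1) ->
    0 <= qform (B q) a.
  move=> bq q01; rewrite -Rintegral_lincomb_sqr//; apply: Rintegral_ge0 => x Sx.
  by have /andP[? _] := q01 _ Sx; rewrite mulr_ge0// sqr_ge0.
have formE q a : qform (fun i j => c * B q i j - A q i j) a =
    c * qform (B q) a - qform (A q) a.
  rewrite /qform mulr_sumr -sumrB; apply: eq_bigr => i _.
  by rewrite mulr_sumr -sumrB; apply: eq_bigr => j _; ring.
have Bgpos a : (exists i, a i != 0) -> 0 < qform (B g) a.
  move=> [i ai]; rewrite lt_neqAle Bge0// andbT eq_sym; apply/eqP => Ba0.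
  move/eqP: ai; apply; apply: indu.
  by apply/eq_on_support_Rintegral => //; rewrite Rintegral_lincomb_sqr.
have ABgpos a : (exists i, a i != 0) ->
    0 < qform (fun i j => c * B g i j - A g i j) a.
  (* Positivity of the mass form at [a] makes the quotient of [lincomb u a] admissible; it lies
     below [c] because the supremum does. *)
  move=> a0; rewrite formE subr_gt0 -ltr_pdivrMr ?Bgpos//.
  rewrite -lte_fin; apply: le_lt_trans Mc; apply: ereal_sup_ubound => /=.
  exists (lincomb u a).
    split; first by exists a.
    move/(eq_on_support_Rintegral mg g01 (bl a)).
    by rewrite Rintegral_lincomb_sqr// => Ba0; have := Bgpos _ a0; rewrite Ba0 ltxx.
  by rewrite /rayleigh Rintegral_grad_lincomb_sqr// Rintegral_lincomb_sqr.
have Bcvg i j : B (r t) i j @[t --> U] --> B g i j.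
  by apply: rg; exact: bounded_mfunM.
have ABcvg i j : (c * B (r t) i j - A (r t) i j) @[t --> U] -->
    c * B g i j - A g i j.
  apply: cvgB; first exact: cvgMr.
  by apply: rg; exact: grad_dot_bounded.
(* Each of the three conditions holds near [U], so a single index satisfies them all. *)
have [t [Bt ABt tc]] : exists t, [/\
    forall a, (exists i, a i != 0) -> 0 < qform (B (r t)) a,
    forall a, (exists i, a i != 0) ->
      0 < qform (fun i j => c * B (r t) i j - A (r t) i j) a &
    (c%:E < neumann_eigenvalue k (r t))%E].
  apply: (@filter_ex _ U); near=> t; split.
  - by near: t; exact: qform_gt0_near Bgpos.
  - by near: t; exact: qform_gt0_near ABgpos.
  - by near: t; exact: rs.
suff : (neumann_eigenvalue k (r t) <= c%:E)%E by rewrite leNgt tc.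
apply: (@le_trans _ _ (ereal_sup [set (rayleigh (r t) v)%:E |
    v in range (lincomb u) `\` [set v | eq_on_support (r t) v (cst 0)]])).
  (* The same functions span a test space for [r t]: positive definiteness of [B (r t)] is their
     independence there. *)
  apply: ereal_inf_lbound; exists (range (lincomb u)) => //.
  exists u; split=> // a.
  move/(eq_on_support_Rintegral (mr t) (@r01 t) (bl a)).
  rewrite Rintegral_lincomb_sqr// => Ba0 i; apply/eqP/negPn/negP => ai.
  by have := Bt a (ex_intro _ i ai); rewrite Ba0 ltxx.
apply: ge_ereal_sup => _ [_ [[a _ <-] /= na] <-].
have a0 : exists i, a i != 0.
  apply: lincomb_neq0 => ua; apply: na; rewrite ua.
  by apply: aeW.
rewrite lee_fin /rayleigh Rintegral_grad_lincomb_sqr// Rintegral_lincomb_sqr//.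
rewrite ler_pdivrMr ?Bt//; have := ABt a a0; rewrite formE subr_gt0.
exact: ltW.
Unshelve. all: by end_near. Qed.

End upper_semicontinuity.

(** * Existence of a maximizing density *)

Theorem theorem1 (R : realType) (n k : nat) (m : R) (hn : (1 <= n)%N)
    (hm0 : 0 <= m) (hm1 : (m%:E <= @surface_measure R n (@sphere R n))%E) :
  exists2 rho : 'rV[R]_n.+1 -> R,
    densities m rho &
    neumann_eigenvalue k rho =
      ereal_sup [set neumann_eigenvalue k r | r in @densities R n m].
Proof.
set s := ereal_sup _.
have ubs (r : 'rV[R]_n.+1 -> R) : densities m r -> (neumann_eigenvalue k r <= s)%E.
  by move=> dr; apply: ereal_sup_ubound; exists r.
have [r0 dr0] := densities_nonempty hm0 hm1.
(* The filter below uses thresholds strictly under [s]; if there are none, every density attains the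
   supremum. *)
have [sNy|sNy] := eqVneq s -oo%E.
  exists r0 => //; apply/eqP; rewrite eq_le ubs//=.
  by rewrite sNy leNye.
pose I := {r : 'rV[R]_n.+1 -> R | densities m r}.
pose B (c : \bar R) := [set i : I | (c < neumann_eigenvalue k (sval i))%E].
(* The superlevel sets below [s] generate a filter that replaces a maximizing sequence; an
   ultrafilter finer than it replaces a convergent subsequence. *)
pose F := filter_from [set c | (c < s)%E] B.
have FF : ProperFilter F.
  apply: filter_from_proper.
    apply: filter_from_filter; first by exists -oo%E; rewrite /= ltNye.
    move=> c1 c2 /= c1s c2s; exists (Order.max c1 c2).
      by rewrite /= gt_max c1s.
    by move=> i; rewrite /B/= gt_max => /andP[].
  move=> c /= /ereal_sup_gt[_ [r dr <-] cr].
  by exists (exist _ r dr).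
have [U [UU FU]] := ultraFilterLemma FF.
pose r (i : I) := sval i.
have mr i : measurable_fun (@sphere R n) (r i) by case: (svalP i).
have r01 i x : sphere x -> 0 <= r i x <= 1.
  by case: (svalP i) => _ + _; exact.
have [g [mg g01 rg]] := @weak_star_compact _ _ _ (@surface_measure R n) _
  (@measurable_sphere R n) I U UU r mr r01.
have mgS : measurable_fun (@sphere R n) g by exact: measurable_funTS.
have dg : densities m g.
  split=> //.
  have bg : bounded_mfun (@sphere R n) g by apply: bounded_mfun01.
  have gfin := integrable_fin_num (measurable_sphere (n:=n))
    (bounded_mfun_integrable (@surface_measure R n) (measurable_sphere (n:=n)) bg).
  rewrite -[LHS]fineK//; congr EFin.
  have r1 (q : 'rV[R]_n.+1 -> R) : \int[@surface_measure R n]_(x in @sphere R n) (q x * 1) =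
      \int[@surface_measure R n]_(x in @sphere R n) q x.
    by apply: eq_Rintegral => x _; rewrite mulr1.
  (* Testing against the constant 1 shows that the mass, equal to [m] along the whole family, passes
     to the limit. *)
  have := rg _ (bounded_mfun_cst (@sphere R n) 1); rewrite r1.
  rewrite (_ : (fun i => _) = cst m) => [mcvg|].
    exact: (cvg_unique _ mcvg (cvg_cst m)).
  by apply/funext => i; rewrite r1 /Rintegral; case: (svalP i) => _ _ ->.
exists g => //; apply/eqP; rewrite eq_le ubs//=.
apply: (@neumann_eigenvalue_limit _ _ _ U _ r) => // c cs.
by apply: FU; exists c%:E.
Qed.
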